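(* Let $f:(0,a]\to(0,\infty)$ be a nondecreasing function in $\mathrm{RV}^0_\rho$ with $\rho\in[0,1]$ such that $\lim_{t\to0_+}f(t)=0$. Fix $\delta>0$ and let $\Phi_f(x):=\int_x^\delta\frac{1}{f^-(t)}\,dt$ for $x>0$. Then: (i) If $\rho=0$, then $\Phi_f\in\mathrm{RV}^0_{-\infty}$. In particular, $\Phi_f^{-1}\in\mathrm{RV}_0$ and for every $r>0$, $x^{-r}=o(\Phi_f^{-1}(x))$ as $x\to\infty$. (ii) If $\rho\in(0,1)$, then $\Phi_f\in\mathrm{RV}^0_{1-1/\rho}$. In particular, $\Phi_f^{-1}\in\mathrm{RV}_{\rho/(\rho-1)}$ and $\Phi_f^{-1}(x)=o(x^{-r})$ as $x\to\infty$ for every $0<r<-\rho/(\rho-1)$. (iii) If $\rho=1$ and there exists some $c>0$ such that $f(x)\ge cx$ for all sufficiently small $x>0$, then $\Phi_f\in\mathrm{RV}^0_0$. In particular, $\Phi_f^{-1}\in\mathrm{RV}_{-\infty}$ and for every $r>0$, $\Phi_f^{-1}(x)=o(x^{-r})$ as $x\to\infty$.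
   Context: Minus generalized inverse: for $f:(0,a]\to(0,\infty)$ with $\lim_{x\to0_+}f(x)=0$, $f^-(y):=\sup\{x\in(0,a]\mid f(x)<y\}$, $y>0$. $\Phi_f$ is continuous and decreasing on $(0,\infty)$, and $\Phi_f^{-1}$ denotes its usual inverse. Regular variation: a measurable $f:[a,\infty)\to(0,\infty)$ ($a>0$) is in $\mathrm{RV}_\rho$, $\rho\in\mathbb{R}$, if $\lim_{x\to\infty}f(\lambda x)/f(x)=\lambda^\rho$ for all $\lambda>0$; it is in $\mathrm{RV}_\infty$ if this limit is $0$, $1$, $+\infty$ for $\lambda$ in $(0,1)$, $\{1\}$, $(1,\infty)$ respectively; and $f\in\mathrm{RV}_{-\infty}$ if $1/f\in\mathrm{RV}_\infty$. A measurable $f:(0,a]\to(0,\infty)$ is in $\mathrm{RV}^0_\rho$, $\rho\in\mathbb{R}$, if $\lim_{x\to0_+}f(\lambda x)/f(x)=\lambda^\rho$ for all $\lambda>0$; $\mathrm{RV}^0_{\infty}$ and $\mathrm{RV}^0_{-\infty}$ are defined analogously (with $x\to0_+$). Equivalently $f\in\mathrm{RV}^0_\rho\iff f(1/\cdot)\in\mathrm{RV}_{-\rho}$ for $\rho\in\mathbb{R}\cup\{\pm\infty\}$. Only behaviour near $\infty$ (resp. near $0$) matters: a function is said to belong to one of these classes if its restriction to some $[a,\infty)$ (resp. $(0,a]$) is positive and belongs to it. *)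

(* Defs.v *)
From mathcomp Require Import all_boot all_order all_algebra.
From mathcomp Require Import all_classical all_reals all_analysis.

Set Implicit Arguments.
Unset Strict Implicit.
Unset Printing Implicit Defensive.

Import Order.TTheory GRing.Theory Num.Theory.
Import numFieldNormedType.Exports.

Local Open Scope classical_set_scope.
Local Open Scope ring_scope.

(* Functions on (0, a] or [a, +oo) are represented by total functions R -> R;
   the values outside of these sets never matter. *)

(* Makes the library's little-o notation usable at +oo. *)
Canonical pinfty_filter_on (R : numFieldType) : filter_on R :=
  FilterType (pinfty_nbhs R) _.

Section RegularVariation.
Context {R : realType}.
Implicit Types (F : set_system R) (f : R -> R) (rho : \bar R).

Definition rapid_variation F f : Prop :=
  [/\ forall l, 0 < l < 1 -> f (l * x) / f x @[x --> F] --> (0 : R),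
      f (1 * x) / f x @[x --> F] --> (1 : R)
    & forall l, 1 < l -> f (l * x) / f x @[x --> F] --> +oo].

Definition regular_variation F rho f : Prop :=
  match rho with
  | r%:E => forall l, 0 < l -> f (l * x) / f x @[x --> F] --> l `^ r
  | +oo%E => rapid_variation F f
  | -oo%E => rapid_variation F (fun x => (f x)^-1)
  end.

Definition RV rho f : Prop :=
  exists a : R, [/\ 0 < a, forall x, a <= x -> 0 < f x,
    measurable_fun `[a, +oo[ f & regular_variation +oo rho f].

Definition RV0 rho f : Prop :=
  exists a : R, [/\ 0 < a, forall x, 0 < x <= a -> 0 < f x,
    measurable_fun `]0, a] f & regular_variation 0^'+ rho f].

End RegularVariation.

Section Phi.
Context {R : realType}.
Implicit Types (f g : R -> R) (a b d x y : R).

Definition minus_inverse a f y : R := sup [set x | 0 < x <= a /\ f x < y].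

(* Integral from a to b with the usual sign convention when b < a. *)
Definition oriented_integral g a b : R :=
  if a <= b then \int[lebesgue_measure]_(t in `[a, b]) g t
  else - \int[lebesgue_measure]_(t in `[b, a]) g t.

Definition Phi a f d x : R :=
  oriented_integral (fun t => (minus_inverse a f t)^-1) x d.

(* Inverse of Phi restricted to (0, +oo); it takes the arbitrary value 0
   outside of the range of that restriction. *)
Definition Phi_inv a f d : R -> R :=
  'pinv_(fun=> 0) [set x : R | 0 < x] (Phi a f d).

End Phi.

(* Main.v *)
Require Import Defs.
From mathcomp Require Import all_boot all_order all_algebra.
From mathcomp Require Import all_classical all_reals all_analysis.
From mathcomp Require Import ring lra.

Set Implicit Arguments.
Unset Strict Implicit.
Unset Printing Implicit Defensive.

Import Order.TTheory GRing.Theory Num.Theory.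
Import numFieldNormedType.Exports.

Local Open Scope classical_set_scope.
Local Open Scope ring_scope.

(** Write [g] for the reciprocal of the minus inverse of [f], and [Psi] for the
    inverse of [Phi]. Bounds of the form [f (l x) <= m f x] near 0, which hold
    when [l ^ rho < m], become [l g (m y) <= g y]. Integrating them along a
    geometric progression turns them into [Phi (m x) <= t Phi x] for every
    [t > m / l]: the constant coming from the upper end of the integral is
    negligible because [Phi] tends to +oo at 0, [f] being bounded below by a
    linear function near 0 in all three cases. Inverting once more gives
    [Psi y <= m Psi (y / t)]. The reverse bounds, valid when [m < l ^ rho], are
    transferred in the same way, and the index of [Phi] and of [Psi] is read off
    from the admissible triples [(l, m, t)]. Finally, a bound on
    [Psi (2 y) / Psi y] propagates along powers of 2 to a power bound on [Psi]. *)

(** * Neighbourhoods of 0 and +oo as thresholds *)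

Lemma near_right0P (R : realType) (P : R -> Prop) :
  (\forall x \near 0^'+, P x) <->
  exists2 e : R, 0 < e & forall x : R, 0 < x -> x <= e -> P x.
Proof.
split=> [[e /= e0 eP]|[e e0 eP]].
  exists (e / 2) => [|x x0 xe]; first by rewrite divr_gt0.
  apply: eP => //=; rewrite sub0r normrN gtr0_norm //.
  by rewrite (le_lt_trans xe) // ltr_pdivrMr // ltr_pMr // ltr1n.
exists e => //= x; rewrite /= sub0r normrN => xe x0; apply: eP => //.
by rewrite -(gtr0_norm x0) ltW.
Qed.

Lemma near_pinftyP (R : realType) (P : R -> Prop) :
  (\forall x \near +oo, P x) <->
  exists2 M : R, 0 < M & forall x : R, M <= x -> P x.
Proof.
split=> [[M [_ MP]]|[M M0 MP]].
  exists (`|M| + 1) => [|x Mx]; first by rewrite ltr_wpDl.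
  apply: MP; rewrite (lt_le_trans _ Mx) // (le_lt_trans (ler_norm M)) //.
  by rewrite ltrDl.
by exists M; split => [|x /ltW]; [exact: num_real|exact: MP].
Qed.

(** * Criteria for regular and rapid variation *)

Section ratio_limits.
Context {R : realType} (F : set_system R) {FF : Filter F}.
Context (scaleF : forall (l : R) (P : R -> Prop), 0 < l ->
  (\forall x \near F, P x) -> \forall x \near F, P (l * x)).
Context (h : R -> R) (h_gt0 : \forall x \near F, 0 < h x).

(** Factors [l > 1] suffice: for [l < 1] the ratio is the inverse of the ratio for [l^-1] taken at
    [l * x], and [F] is stable under scaling. *)
Lemma regular_variation_of_bounds (r : R) :
  (forall l t, 1 < l -> l `^ r < t -> \forall x \near F, h (l * x) <= t * h x) ->
  (forall l t, 1 < l -> t < l `^ r -> \forall x \near F, t * h x <= h (l * x)) ->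
  regular_variation F r%:E h.
Proof.
move=> hup hlo.
have gt1 l : 1 < l -> h (l * x) / h x @[x --> F] --> l `^ r.
  move=> l1; apply/cvgrPdist_le => e e0.
  have := hup l (l `^ r + e) l1; rewrite ltrDl => /(_ e0) Hu.
  have := hlo l (l `^ r - e) l1; rewrite gtrDl oppr_lt0 => /(_ e0) Hl.
  near=> x.
  have hx : 0 < h x by near: x.
  rewrite ler_distlC ler_pdivlMr // ler_pdivrMr //.
  by apply/andP; split; near: x.
move=> l l0 /=; have [l1|l1|<-] := ltgtP 1 l.
- exact: gt1.
- have li1 : 1 < l^-1 by rewrite invf_gt1.
  have := gt1 _ li1 => lim.
  have {}lim : h (l^-1 * (l * x)) / h (l * x) @[x --> F] --> (l^-1) `^ r.
    by move=> A /lim; exact: scaleF.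
  have n0 : (l^-1) `^ r != 0 by rewrite gt_eqF // powR_gt0 // invr_gt0.
  have -> : l `^ r = ((l^-1) `^ r)^-1.
    by rewrite -(powR_inv1 (ltW l0)) -powRrM mulN1r powRN invrK.
  apply: cvg_trans (cvgV n0 lim); apply: near_eq_cvg; near=> x => /=.
  by rewrite mulKf ?gt_eqF // invf_div.
- rewrite powR1; apply: cvg_near_cst; near=> x.
  by rewrite mul1r divff // gt_eqF //; near: x.
Unshelve. all: by end_near.
Qed.

(** With [t] arbitrarily small the bound makes the ratio for [l > 1] arbitrarily large; read for
    [l^-1] at the point [l * x], it makes the ratio for [l < 1] arbitrarily small. *)
Lemma rapid_variation_of_bounds :
  (forall l t, 1 < l -> 0 < t -> \forall x \near F, h x <= t * h (l * x)) ->
  rapid_variation F h.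
Proof.
move=> hle; split=> [l /andP[l0 l1]||l l1].
- have li1 : 1 < l^-1 by rewrite invf_gt1.
  apply/cvgrPdist_le => e e0; have := hle _ _ li1 e0 => /(scaleF l0) Hl.
  have hl := scaleF l0 h_gt0.
  near=> x.
  have hx : 0 < h x by near: x.
  have hlx : 0 < h (l * x) by near: x.
  rewrite sub0r normrN gtr0_norm ?divr_gt0 // ler_pdivrMr //.
  near: x; move: Hl; apply: filterS => x; rewrite mulKf ?gt_eqF //.
- apply: cvg_near_cst; near=> x.
  by rewrite mul1r divff // gt_eqF //; near: x.
- apply/cvgryPge => A.
  have A0 : 0 < (`|A| + 1)^-1 by rewrite invr_gt0 ltr_wpDl.
  have := hle _ _ l1 A0 => Hl.
  near=> x.
  have hx : 0 < h x by near: x.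
  rewrite (le_trans (ler_norm A)) // ler_pdivlMr //.
  have : h x <= (`|A| + 1)^-1 * h (l * x) by near: x.
  by rewrite mulrC ler_pdivlMr ?ltr_wpDl // mulrDr mulr1; nra.
Unshelve. all: by end_near.
Qed.

End ratio_limits.

(** * Scaling, measurability of monotone functions, geometric induction *)

Lemma near_right0_scale (R : realType) (l : R) (P : R -> Prop) : 0 < l ->
  (\forall x \near 0^'+, P x) -> \forall x \near 0^'+, P (l * x).
Proof.
move=> l0 /near_right0P[e e0 eP]; apply/near_right0P; exists (e / l).
  by rewrite divr_gt0.
by move=> x x0; rewrite ler_pdivlMr // mulrC => xe; apply: eP => //; rewrite mulr_gt0.
Qed.

Lemma near_pinfty_scale (R : realType) (l : R) (P : R -> Prop) : 0 < l ->
  (\forall x \near +oo, P x) -> \forall x \near +oo, P (l * x).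
Proof.
move=> l0 /near_pinftyP[M M0 MP]; apply/near_pinftyP; exists (M / l).
  by rewrite divr_gt0.
by move=> x; rewrite ler_pdivrMr // mulrC => xe; apply: MP.
Qed.

(** The preimage of a ray [[r, +oo[] is an interval, hence measurable, and these rays generate the
    Borel sets. *)
Lemma nonincreasing_on_measurable (R : realType) (i : interval R) (h : R -> R) :
  (forall x y, x \in i -> y \in i -> x <= y -> h y <= h x) ->
  measurable_fun [set` i] h.
Proof.
move=> hni; apply: (measurability (@measurable_realfun.RGenCInfty.G R)) => [|/= _ [_] [r] -> <-].
  exact: measurable_realfun.RGenCInfty.measurableE.
apply: measurable_realfun.is_interval_measurable => s t /=.
have rE y : (y \in `[r, +oo[) = (r <= y) by rewrite in_itv /= andbT.
move=> [si]; rewrite rE => rs [ti]; rewrite rE => rt u /andP[su ut].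
have ui : u \in i by apply: (interval_is_interval si ti); apply/andP.
by split => //; rewrite rE (le_trans rt) // hni.
Qed.

Lemma expr_unbounded (R : realType) (k A : R) : 1 < k -> exists n, A <= k ^+ n.
Proof.
move=> k1; have bernoulli n : 1 + n%:R * (k - 1) <= k ^+ n.
  elim: n => [|n IH]; first by rewrite mul0r addr0 expr0.
  have k0 : 0 <= k by rewrite (le_trans _ (ltW k1)).
  rewrite exprS -natr1; apply: le_trans (ler_wpM2l k0 IH).
  have := mulr_ge0 (ler0n R n) (sqr_ge0 (k - 1)); lra.
have k10 : 0 < k - 1 by rewrite subr_gt0.
have B0 : 0 <= `|A| / (k - 1) by rewrite divr_ge0 ?(ltW k10).
exists (Num.Def.archi_bound (`|A| / (k - 1))).
apply: le_trans (bernoulli _); have := archi_boundP B0.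
by rewrite ltr_pdivrMr //; have := ler_norm A; lra.
Qed.

(** Finitely many divisions by [k] bring any [x >= M] back into [[M, k * M]]; the induction is on a
    bound for their number. *)
Lemma multiplicative_propagation (R : realType) (q : R -> R) (k M c : R) :
  1 < k -> 0 < M ->
  (forall x, M <= x -> q x <= q (k * x)) ->
  (forall x, M <= x -> x <= k * M -> c <= q x) ->
  forall x, M <= x -> c <= q x.
Proof.
move=> k1 M0 qq qc; have k0 : 0 < k by rewrite (lt_trans _ k1).
have H n x : M <= x -> x <= k ^+ n * (k * M) -> c <= q x.
  elim: n x => [|n IH] x Mx; first by rewrite expr0 mul1r; exact: qc.
  have [x2M _|Mx2 xn] := leP x (k * M); first exact: qc.
  have Mx' : M <= x / k by rewrite ler_pdivlMr // mulrC ltW.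
  have := qq _ Mx'; rewrite (mulrC k) divfK ?gt_eqF // => /(le_trans _); apply.
  by apply: IH => //; rewrite ler_pdivrMr // mulrAC -exprSr.
move=> x Mx; have [n xn] := expr_unbounded (x / (k * M)) k1.
by apply: (H n) => //; rewrite -ler_pdivrMr // mulr_gt0.
Qed.

(** The mirror image at 0, obtained by [x -> 1 / x] and a change of sign. *)
Lemma multiplicative_propagation0 (R : realType) (H : R -> R) (k e c : R) :
  1 < k -> 0 < e ->
  (forall x, 0 < x -> k * x <= e -> H x <= H (k * x)) ->
  (forall x, e / k <= x -> x <= e -> H x <= c) ->
  forall x, 0 < x -> x <= e -> H x <= c.
Proof.
move=> k1 e0 Hk Hc x x0 xe; have k0 : 0 < k by rewrite (lt_trans _ k1).
rewrite -lerN2 -[x]invrK; apply: (@multiplicative_propagation R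
  (fun y => - H y^-1) k e^-1) => //; rewrite ?invr_gt0 ?lef_pV2 //.
- move=> y ey; have y0 : 0 < y by rewrite (lt_le_trans _ ey) ?invr_gt0.
  have ky : k * (k * y)^-1 = y^-1 by rewrite invfM mulrA divff ?gt_eqF ?mul1r.
  rewrite lerN2 -[X in _ <= H X]ky; apply: Hk; first by rewrite invr_gt0 mulr_gt0.
  by rewrite ky -[leRHS]invrK lef_pV2 ?posrE ?invr_gt0.
- move=> y ey yk; have y0 : 0 < y by rewrite (lt_le_trans _ ey) ?invr_gt0.
  rewrite lerN2; apply: Hc.
    by rewrite -[leLHS]invrK lef_pV2 ?posrE ?invr_gt0 ?divr_gt0 // invf_div.
  by rewrite -[leRHS]invrK lef_pV2 ?posrE ?invr_gt0.
Qed.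

(** * Scaling bounds for the minus inverse *)

Section minus_inverse.
Context {R : realType} (a : R) (f : R -> R).
Context (a_gt0 : 0 < a) (f_gt0 : forall x : R, 0 < x <= a -> 0 < f x).
Context (f_nondecr : forall x y : R, 0 < x -> x <= y -> y <= a -> f x <= f y).
Context (f_lim0 : f t @[t --> 0^'+] --> (0 : R)).
Local Notation finv := (minus_inverse a f).

(** The limit of [f] at 0 makes the set nonempty and [a] bounds it, so that [sup] is a genuine
    supremum. *)
Lemma minus_inverse_has_sup (y : R) : 0 < y ->
  has_sup [set x | 0 < x <= a /\ f x < y].
Proof.
move=> y0; split; last by exists a => x [/andP[]].
have /near_right0P[e e0 ef] : \forall x \near 0^'+, f x < y.
  exact: (cvgr_lt _ f_lim0).
exists (Num.min e a); split; last by apply: ef; rewrite ?ge_min ?lexx // lt_min e0.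
by rewrite lt_min e0 a_gt0 /= ge_min lexx orbT.
Qed.

Lemma minus_inverse_le (y c : R) : 0 < y ->
  (forall x : R, 0 < x -> x <= a -> f x < y -> x <= c) -> finv y <= c.
Proof.
move=> y0 H; apply: ge_sup; first by have [] := minus_inverse_has_sup y0.
by move=> x [/andP[x0 xa] fxy]; exact: H.
Qed.

Lemma le_minus_inverse (y x : R) : 0 < x -> x <= a -> f x < y -> x <= finv y.
Proof.
move=> x0 xa fxy; apply: sup_upper_bound; last by split => //; rewrite x0.
by apply: minus_inverse_has_sup; rewrite (lt_trans _ fxy) // f_gt0 // x0.
Qed.

Lemma minus_inverse_gt0 (y : R) : 0 < y -> 0 < finv y.
Proof.
move=> y0; have [[x [/andP[x0 xa] fxy]] _] := minus_inverse_has_sup y0.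
by rewrite (lt_le_trans x0) // le_minus_inverse.
Qed.

Lemma minus_inverse_nondecr (y z : R) : 0 < y -> y <= z -> finv y <= finv z.
Proof.
move=> y0 yz; apply: minus_inverse_le => // x x0 xa fxy.
by apply: le_minus_inverse => //; exact: lt_le_trans yz.
Qed.

Lemma lt_of_image (x y : R) : 0 < x -> x <= a -> 0 < y -> y <= a -> f x < f y -> x < y.
Proof.
by move=> x0 xa y0 ya; apply: contraTT; rewrite -!leNgt => yx; exact: f_nondecr.
Qed.

(** If [f x < y] then [f (l * x) <= m * f x < m * y], so [l] maps the sublevel set of [y] into that
    of [m * y]. *)
Lemma minus_inverse_scale_ge (l m : R) : 1 < l -> 0 < m ->
  (\forall x \near 0^'+, f (l * x) <= m * f x) ->
  \forall y \near 0^'+, l * finv y <= finv (m * y).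
Proof.
move=> l1 m0 /near_right0P[e e0 ef].
have l0 : 0 < l by rewrite (lt_trans _ l1).
(* Below [x0] the bound on [f] holds and [l * x] stays within [a]; [y <= f x0] then forces every [x]
   with [f x < y] below [x0]. *)
pose x0 := Num.min e (a / l).
have x00 : 0 < x0 by rewrite lt_min e0 divr_gt0.
have x0e : x0 <= e by rewrite ge_min lexx.
have lx0a : l * x0 <= a by rewrite mulrC -ler_pdivlMr // ge_min lexx orbT.
have x0a : x0 <= a by rewrite (le_trans _ lx0a) // ler_peMl // ltW.
apply/near_right0P; exists (f x0); first by rewrite f_gt0 // x00.
move=> y y0 yf; rewrite mulrC -ler_pdivlMr //.
apply: minus_inverse_le => // x x_gt0 xa fxy.
have xx0 : x < x0 by apply: lt_of_image => //; exact: lt_le_trans yf.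
rewrite ler_pdivlMr // mulrC; apply: le_minus_inverse.
- by rewrite mulr_gt0.
- by rewrite (le_trans _ lx0a) // ler_pM2l // ltW.
- rewrite (le_lt_trans (ef _ _ _)) // ?ltr_pM2l //.
  by rewrite (le_trans _ x0e) // ltW.
Qed.

(** Conversely, division by [l] maps the sublevel set of [m * y] into that of [y], since
    [m * f (z / l) <= f z < m * y]. *)
Lemma minus_inverse_scale_le (l m : R) : 1 < l -> 0 < m ->
  (\forall x \near 0^'+, m * f x <= f (l * x)) ->
  \forall y \near 0^'+, finv (m * y) <= l * finv y.
Proof.
move=> l1 m0 /near_right0P[e e0 ef].
have l0 : 0 < l by rewrite (lt_trans _ l1).
pose x0 := Num.min e (a / l).
have x00 : 0 < x0 by rewrite lt_min e0 divr_gt0.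
have x0e : x0 <= e by rewrite ge_min lexx.
have lx00 : 0 < l * x0 by rewrite mulr_gt0.
have lx0a : l * x0 <= a by rewrite mulrC -ler_pdivlMr // ge_min lexx orbT.
(* For such [y], [m * y <= f (l * x0)], so that [f z < m * y] gives [z / l <= x0]. *)
apply/near_right0P; exists (f (l * x0) / m).
  by rewrite divr_gt0 // f_gt0 // lx00.
move=> y y0; rewrite ler_pdivlMr // mulrC => yf.
apply: minus_inverse_le => [|z z0 za fzy]; first by rewrite mulr_gt0.
have zx0 : z < l * x0 by apply: lt_of_image => //; exact: lt_le_trans yf.
have zl0 : 0 < z / l by rewrite divr_gt0.
have zlx0 : z / l <= x0 by rewrite ler_pdivrMr // mulrC ltW.
rewrite mulrC -ler_pdivrMr //; apply: le_minus_inverse => //.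
  by rewrite (le_trans _ za) // ler_pdivrMr // ler_peMr // ltW.
rewrite -(ltr_pM2l m0) (le_lt_trans (ef _ _ _)) //.
  by rewrite (le_trans zlx0).
by rewrite (mulrC l) divfK // gt_eqF.
Qed.

(** Serves to bound the integrand from below by [c / y], which makes the integral diverge at 0. *)
Lemma minus_inverse_linear (c : R) : 0 < c ->
  (\forall x \near 0^'+, c * x <= f x) ->
  \forall y \near 0^'+, finv y <= y / c.
Proof.
move=> c0 /near_right0P[e e0 ef].
pose x0 := Num.min e a.
have x00 : 0 < x0 by rewrite lt_min e0.
have x0e : x0 <= e by rewrite ge_min lexx.
have x0a : x0 <= a by rewrite ge_min lexx orbT.
apply/near_right0P; exists (f x0); first by rewrite f_gt0 // x00.
move=> y y0 yf; apply: minus_inverse_le => // x x_gt0 xa fxy.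
have xx0 : x < x0 by apply: lt_of_image => //; exact: lt_le_trans yf.
rewrite ler_pdivlMr // mulrC (le_trans (ef _ _ _)) // ?(ltW fxy) //.
by rewrite (le_trans _ x0e) // ltW.
Qed.

End minus_inverse.

(** Under the doubling bound, [f x / x] does not decrease when [x] is halved, so its lower bound
    [f (e / 2) / e] on [[e / 2, e]] extends to all smaller [x]. *)
Lemma linear_lower_bound (R : realType) (f : R -> R) :
  (\forall x \near 0^'+, 0 < f x) ->
  (exists2 e, 0 < e & forall x y : R, 0 < x -> x <= y -> y <= e -> f x <= f y) ->
  (\forall x \near 0^'+, f (2 * x) <= 2 * f x) ->
  exists2 c : R, 0 < c & \forall x \near 0^'+, c * x <= f x.
Proof.
move=> /near_right0P[e1 e10 f_gt0] [e2 e20 f_nd] /near_right0P[e3 e30 f2].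
pose e := Num.min e1 (Num.min e2 e3).
have e0 : 0 < e by rewrite !lt_min e10 e20.
have ee1 : e <= e1 by rewrite ge_min lexx.
have ee2 : e <= e2 by rewrite !ge_min lexx !orbT.
have ee3 : e <= e3 by rewrite !ge_min lexx !orbT.
exists (f (e / 2) / e).
  by rewrite divr_gt0 // f_gt0 ?divr_gt0 // (le_trans _ ee1) // ler_pdivrMr //; lra.
apply/near_right0P; exists e => // x x0 xe.
rewrite -ler_pdivlMr // -lerN2; move: x x0 xe.
apply: (@multiplicative_propagation0 _ (fun x => - (f x / x)) 2) => //.
- by rewrite ltr1n.
- move=> x x0 xe; rewrite lerN2 invfM mulrA ler_pM2r ?invr_gt0 //.
  by rewrite ler_pdivrMr // (mulrC _ 2) f2 // (le_trans _ ee3) //; lra.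
- move=> x ex xe; have eh0 : 0 < e / 2 by rewrite divr_gt0.
  have x0 := lt_le_trans eh0 ex; rewrite lerN2 ler_pM //.
  + by rewrite ltW // f_gt0 // (le_trans _ ee1) //; lra.
  + by rewrite invr_ge0 ltW.
  + by apply: f_nd => //; exact: le_trans ee2.
  + by rewrite lef_pV2.
Qed.

(** * The oriented integral of a nonincreasing function *)

Section oriented_integral.
Context {R : realType} (g : R -> R).
Context (g_ni : forall x y : R, 0 < x -> x <= y -> g y <= g x).
Local Notation mu := (@lebesgue_measure R).

Lemma nonincreasing_integrable (x y : R) : 0 < x ->
  mu.-integrable `[x, y] (EFin \o g).
Proof.
move=> x0; apply: measurable_bounded_integrable => //=.
- by rewrite lebesgue_measure_itv /=; case: ifP => _; rewrite ?ltry // -EFinB ltry.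
- apply: nonincreasing_on_measurable => u v; rewrite !in_itv /= => /andP[xu _] _ uv.
  by apply: g_ni => //; exact: lt_le_trans xu.
(* The values of [g] lie between [g y] and [g x], whose signs are not prescribed. *)
- exists (`|g x| + `|g y|); split; first exact: num_real.
  move=> M hM u /=; rewrite in_itv /= => /andP[xu uy].
  have gu1 := g_ni x0 xu; have gu2 := g_ni (lt_le_trans x0 xu) uy.
  rewrite (le_trans _ (ltW hM)) // ler_norml.
  have := ler_norm (g x); have := ler_norm (- g y); rewrite normrN.
  have := normr_ge0 (g x); have := normr_ge0 (g y); lra.
Qed.

Lemma Rintegral_itv_split (x y z : R) : 0 < x -> x <= y -> y <= z ->
  \int[mu]_(t in `[x, z]) g t =
  \int[mu]_(t in `[x, y]) g t + \int[mu]_(t in `[y, z]) g t.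
Proof.
move=> x0 xy yz; have y0 := lt_le_trans x0 xy.
have := @Rintegral_itvB R g (BLeft x) (BRight z) y (nonincreasing_integrable z x0).
rewrite !bnd_simp => /(_ xy yz) H.
rewrite -(@Rintegral_itv_obnd_cbnd R y (BRight z)); first by rewrite -H; ring.
apply: integrableS (nonincreasing_integrable z y0) => //=.
by apply: subset_itvr; rewrite bnd_simp.
Qed.

Lemma oriented_integralB (x y d : R) : 0 < d -> 0 < x -> x <= y ->
  oriented_integral g x d - oriented_integral g y d =
  \int[mu]_(t in `[x, y]) g t.
Proof.
move=> d0 x0 xy; have y0 := lt_le_trans x0 xy; rewrite /oriented_integral.
have [xd|dx] := leP x d; have [yd|dy] := leP y d.
- by rewrite (Rintegral_itv_split x0 xy yd); ring.
- by rewrite (Rintegral_itv_split x0 xd (ltW dy)); ring.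
(* Here [d < x <= y <= d], a contradiction. *)
- by lra.
- by rewrite (Rintegral_itv_split d0 (ltW dx) xy); ring.
Qed.

(** Lower and upper rectangles of a nonincreasing integrand; the integral enters the rest of the
    argument only through these bounds. *)
Lemma oriented_integral_bounds (x y d : R) : 0 < d -> 0 < x -> x <= y ->
  (y - x) * g y <= oriented_integral g x d - oriented_integral g y d
    <= (y - x) * g x.
Proof.
move=> d0 x0 xy; rewrite oriented_integralB //.
have cstE (c : R) : (y - x) * c = \int[mu]_(t in `[x, y]) c.
  rewrite Rintegral_cst //= lebesgue_measure_itv /= lte_fin.
  by case: ltgtP xy => // [_ _|-> _]; rewrite ?subrr /= ?mulr0 ?mul0r // mulrC.
have ig := nonincreasing_integrable y x0.
have ic (c : R) : mu.-integrable `[x, y] (EFin \o cst c).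
  apply: measurable_bounded_integrable => //=; last exact: bounded_cst.
  by rewrite lebesgue_measure_itv /=; case: ifP => _; rewrite ?ltry // -EFinB ltry.
rewrite !cstE; apply/andP; split; apply: le_Rintegral => //; try exact: ic.
  move=> t /=; rewrite in_itv /= => /andP[xt ty].
  by apply: g_ni => //; exact: lt_le_trans xt.
by move=> t /=; rewrite in_itv /= => /andP[xt _]; exact: g_ni.
Qed.

End oriented_integral.

(** * From scaling bounds on the integrand to scaling bounds on its primitive *)

Section scaling_transfer.
Context {R : realType} (g Phi : R -> R).
Context (g_gt0 : forall x : R, 0 < x -> 0 < g x).
Context (g_ni : forall x y : R, 0 < x -> x <= y -> g y <= g x).
Context (Phi_bounds : forall x y : R, 0 < x -> x <= y ->
  (y - x) * g y <= Phi x - Phi y <= (y - x) * g x).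

Lemma integral_decr (x y : R) : 0 < x -> x < y -> Phi y < Phi x.
Proof.
move=> x0 xy; have /andP[] := Phi_bounds x0 (ltW xy).
have := mulr_gt0 (_ : 0 < y - x) (g_gt0 (lt_trans x0 xy)).
by rewrite subr_gt0 => /(_ xy); lra.
Qed.

Lemma integral_nonincr (x y : R) : 0 < x -> x <= y -> Phi y <= Phi x.
Proof.
by move=> x0; rewrite le_eqVlt => /orP[/eqP->//|/(integral_decr x0)/ltW].
Qed.

(** On [[x / 2, +oo[], away from the singularity at 0, [Phi] is Lipschitz with constant
    [g (x / 2)]. *)
Lemma integral_continuous (x : R) : 0 < x -> {for x, continuous Phi}.
Proof.
move=> x0; have x20 : 0 < x / 2 by rewrite divr_gt0.
have gx := g_gt0 x20.
have lip (u v : R) : x / 2 <= u -> u <= v ->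
    `|Phi u - Phi v| <= `|u - v| * g (x / 2).
  move=> xu uv; have u0 := lt_le_trans x20 xu.
  have /andP[_ H1] := Phi_bounds u0 uv.
  rewrite ger0_norm ?subr_ge0 ?integral_nonincr // (le_trans H1) //.
  by rewrite distrC ger0_norm ?subr_ge0 // ler_wpM2l ?subr_ge0 // g_ni.
apply/cvgrPdist_le => e e0; near=> y.
have xy : x / 2 <= y by apply/ltW; near: y; apply: lt_nbhsr; lra.
have dxy : `|x - y| <= e / g (x / 2).
  near: y; apply: cvgr_dist_le; last by rewrite divr_gt0.
  exact: cvg_id.
rewrite ler_pdivlMr // in dxy; apply: le_trans dxy.
have [xy'|/ltW yx] := leP x y; first by apply: lip => //; lra.
by rewrite distrC (distrC x); exact: lip.
Unshelve. all: by end_near.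
Qed.

(** Logarithmic divergence: each dyadic interval [[x, 2 * x]] contributes at least
    [x * g (2 * x) >= c / 2]. *)
Lemma integral_unbounded (c : R) : 0 < c ->
  (\forall x \near 0^'+, c <= x * g x) ->
  forall A : R, \forall x \near 0^'+, A <= Phi x.
Proof.
move=> c0 /near_right0P[e e0 ge] A.
have H n : Phi e + n%:R * (c / 2) <= Phi (e / 2 ^+ n).
  elim: n => [|n IH]; first by rewrite mul0r addr0 expr0 divr1.
  have p0 : 0 < 2 ^+ n.+1 :> R by rewrite exprn_gt0.
  set x := e / 2 ^+ n.+1.
  have x0 : 0 < x by rewrite divr_gt0.
  have xE : e / 2 ^+ n = 2 * x.
    by rewrite /x exprS; field; rewrite expf_neq0 ?pnatr_eq0.
  have xx : x <= 2 * x by lra.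
  have xe : 2 * x <= e.
    by rewrite -xE ler_pdivrMr ?exprn_gt0 // ler_peMr ?(ltW e0) // exprn_ege1 // ler1n.
  have /andP[H1 _] := Phi_bounds x0 xx.
  have x20 : 0 < 2 * x by rewrite mulr_gt0.
  have H2 := ge _ x20 xe.
  by rewrite xE in IH; rewrite -natr1; lra.
have [B0 nB] : 0 <= `|A - Phi e| / (c / 2) /\ 0 < c / 2.
  by rewrite !divr_ge0 ?divr_gt0 // ltW.
have := archi_boundP B0; set n := Num.Def.archi_bound _; rewrite ltr_pdivrMr // => An.
apply/near_right0P; exists (e / 2 ^+ n); first by rewrite divr_gt0 ?exprn_gt0.
move=> x x0 xe; apply: le_trans (integral_nonincr x0 xe).
by apply: le_trans (H n); have := ler_norm (A - Phi e); lra.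
Qed.

Context (Phi_infty : forall A : R, \forall x \near 0^'+, A <= Phi x).

(* The primitive is compared along a geometric progression of ratio [q]: the
   gap between [m / q] and [m] absorbs the error of the Riemann sums. *)
Lemma integral_scale_le (m l q t : R) : 0 < m -> 0 < l -> 1 < q -> m / l < t ->
  (\forall y \near 0^'+, l * g (m / q * y) <= g y) ->
  \forall x \near 0^'+, Phi (m * x) <= t * Phi x.
Proof.
move=> m0 l0 q1 mlt /near_right0P[e e0 ge].
have q0 : 0 < q by rewrite (lt_trans _ q1).
have k0 : 0 < m / l by rewrite divr_gt0.
have eq0 : 0 < e / q by rewrite divr_gt0.
(* By monotonicity, [C] bounds the difference on the last interval [[e / q, e]] of the
   progression. *)
pose C := Phi (m * (e / q)) - m / l * Phi e.
have H (x : R) : 0 < x -> x <= e -> Phi (m * x) - m / l * Phi x <= C.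
  apply: (@multiplicative_propagation0 _ (fun x => Phi (m * x) - m / l * Phi x) q)
    => // {}x.
    move=> x0 qxe; have qx0 : 0 < q * x by rewrite mulr_gt0.
    have xqx : x <= q * x by rewrite ler_peMl // ltW.
    have mx0 : 0 < m * x by rewrite mulr_gt0.
    have mxqx : m * x <= m * (q * x) by rewrite ler_pM2l.
    (* The lower rectangle on [[x, q * x]] has height [g (q * x)], the upper one on its image under
       [m] has height [g (m * x)]; [ge] at [q * x] relates exactly these two. *)
    have /andP[H1 _] := Phi_bounds x0 xqx.
    have /andP[_ H2] := Phi_bounds mx0 mxqx.
    have := ge _ qx0 qxe; rewrite mulrA divfK ?gt_eqF // => H3.
    have H4 := ler_wpM2l (ltW k0) H1.
    have w0 : 0 <= m / l * (q * x - x) by rewrite mulr_ge0 ?(ltW k0) // subr_ge0.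
    have H5 := ler_wpM2l w0 H3.
    have E : m / l * (q * x - x) * (l * g (m * x)) = (m * (q * x) - m * x) * g (m * x).
      by field; rewrite gt_eqF.
    by rewrite E -mulrA in H5; lra.
  move=> ex xe; have x0 := lt_le_trans eq0 ex.
  have mx0 : 0 < m * (e / q) by rewrite pmulr_rgt0.
  by rewrite /C; apply: lerB; rewrite ?ler_pM2l //; apply: integral_nonincr => //;
    rewrite ler_pM2l.
(* Near 0, [(t - m / l) * Phi x] exceeds [C], which absorbs the constant. *)
have := Phi_infty (C / (t - m / l)) => /near_right0P[e' e'0 Ce'].
have tml : 0 < t - m / l by rewrite subr_gt0.
apply/near_right0P; exists (Num.min e e') => [|x x0]; first by rewrite lt_min e0.
rewrite le_min => /andP[xe xe'].
have := H x x0 xe; have := Ce' x x0 xe'; rewrite ler_pdivrMr //; lra.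
Qed.

(** The same comparison with upper and lower rectangles exchanged, so that heights [g x] and
    [g (m * q * x)] meet and [q] multiplies [m] instead of dividing it. *)
Lemma integral_scale_ge (m l q t : R) : 0 < m -> 0 < l -> 1 < q -> t < m / l ->
  (\forall y \near 0^'+, g y <= l * g (m * q * y)) ->
  \forall x \near 0^'+, t * Phi x <= Phi (m * x).
Proof.
move=> m0 l0 q1 mlt /near_right0P[e e0 ge].
have q0 : 0 < q by rewrite (lt_trans _ q1).
have k0 : 0 < m / l by rewrite divr_gt0.
have eq0 : 0 < e / q by rewrite divr_gt0.
pose C := m / l * Phi (e / q) - Phi (m * e).
have H (x : R) : 0 < x -> x <= e -> m / l * Phi x - Phi (m * x) <= C.
  apply: (@multiplicative_propagation0 _ (fun x => m / l * Phi x - Phi (m * x)) q)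
    => // {}x.
    move=> x0 qxe; have qx0 : 0 < q * x by rewrite mulr_gt0.
    have xqx : x <= q * x by rewrite ler_peMl // ltW.
    have mx0 : 0 < m * x by rewrite mulr_gt0.
    have mxqx : m * x <= m * (q * x) by rewrite ler_pM2l.
    have /andP[_ H1] := Phi_bounds x0 xqx.
    have /andP[H2 _] := Phi_bounds mx0 mxqx.
    have := ge _ x0 (le_trans xqx qxe); rewrite -mulrA => H3.
    have H4 := ler_wpM2l (ltW k0) H1.
    have w0 : 0 <= m / l * (q * x - x) by rewrite mulr_ge0 ?(ltW k0) // subr_ge0.
    have H5 := ler_wpM2l w0 H3.
    have E : m / l * (q * x - x) * (l * g (m * (q * x))) =
        (m * (q * x) - m * x) * g (m * (q * x)).
      by field; rewrite gt_eqF.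
    by rewrite E -mulrA in H5; lra.
  move=> ex xe; have x0 := lt_le_trans eq0 ex.
  have mx0 : 0 < m * x by rewrite pmulr_rgt0.
  by rewrite /C; apply: lerB; rewrite ?ler_pM2l //; apply: integral_nonincr => //;
    rewrite ler_pM2l.
have := Phi_infty (C / (m / l - t)) => /near_right0P[e' e'0 Ce'].
have tml : 0 < m / l - t by rewrite subr_gt0.
apply/near_right0P; exists (Num.min e e') => [|x x0]; first by rewrite lt_min e0.
rewrite le_min => /andP[xe xe'].
have := H x x0 xe; have := Ce' x x0 xe'; rewrite ler_pdivrMr //; lra.
Qed.

End scaling_transfer.

(** * The inverse of a decreasing function unbounded at 0 *)

Section decreasing_inverse.
Context {R : realType} (Phi : R -> R).
Context (Phi_decr : forall x y : R, 0 < x -> x < y -> Phi y < Phi x).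
Context (Phi_cont : forall x : R, 0 < x -> {for x, continuous Phi}).
Context (Phi_infty : forall A : R, \forall x \near 0^'+, A <= Phi x).
Local Notation Psi := ('pinv_(fun=> 0) [set x : R | 0 < x] Phi).

Lemma decreasing_onto (z v : R) : 0 < z -> Phi z <= v -> exists2 x, 0 < x & Phi x = v.
Proof.
move=> z0 zv; have /near_right0P[e e0 ev] := Phi_infty v.
pose x0 := Num.min e z.
have x00 : 0 < x0 by rewrite lt_min e0.
have x0z : x0 <= z by rewrite ge_min lexx orbT.
have vx0 : v <= Phi x0 by apply: ev => //; rewrite ge_min lexx.
have cPhi : {within `[x0, z], continuous Phi}.
  apply: continuous_in_subspaceT => x; rewrite inE /= in_itv /= => /andP[x0x _].
  by apply: Phi_cont; exact: lt_le_trans x0x.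
have [|x xI <-] := @IVT _ _ _ _ v x0z cPhi.
  by rewrite ge_min zv orbT le_max vx0.
exists x => //; move: xI; rewrite in_itv /= => /andP[x0x _].
exact: lt_le_trans x0x.
Qed.

(** The intermediate value theorem puts every [v >= Phi z] in the range of [Phi], where the partial
    inverse does not take its default value. *)
Lemma inverse_correct (z v : R) : 0 < z -> Phi z <= v -> 0 < Psi v /\ Phi (Psi v) = v.
Proof.
move=> z0 zv; have [x x0 xv] := decreasing_onto z0 zv.
have im : [set Phi x | x in [set x | 0 < x]] v by exists x.
have inj : {in [set x | 0 < x] &, injective Phi}.
  move=> u w; rewrite !inE /= => u0 w0 uw.
  have [uw'|wu'|//] := ltgtP u w.
    by have := Phi_decr u0 uw'; rewrite uw ltxx.
  by have := Phi_decr w0 wu'; rewrite uw ltxx.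
split; last by apply: pinvK; rewrite inE.
by have [fS _ _] := injpinv_bij (fun=> 0) inj; exact: (fS v im).
Qed.

Lemma inverse_decreasing_le (x y : R) : 0 < x -> 0 < y -> Phi x <= Phi y -> y <= x.
Proof.
by move=> x0 y0; apply: contraTT; rewrite -!ltNge => xy; exact: Phi_decr.
Qed.

Lemma near_inverse_correct :
  \forall v \near +oo, 0 < Psi v /\ Phi (Psi v) = v.
Proof.
apply/near_pinftyP; exists (`|Phi 1| + 1) => [|v vM].
  by rewrite ltr_wpDl.
apply: (@inverse_correct 1) => //; have := ler_norm (Phi 1); lra.
Qed.

Lemma inverse_nonincr : exists2 M : R, 0 < M &
  forall u v : R, M <= u -> u <= v -> [/\ 0 < Psi u, 0 < Psi v & Psi v <= Psi u].
Proof.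
have /near_pinftyP[M M0 MP] := near_inverse_correct; exists M => // u v Mu uv.
have [u0 uE] := MP _ Mu; have [v0 vE] := MP _ (le_trans Mu uv).
by split=> //; apply: inverse_decreasing_le => //; rewrite uE vE.
Qed.

(** [Psi] tends to 0 from the right: [v >= Phi e] gives [Psi v <= e]. *)
Lemma near_inverse (P : R -> Prop) :
  (\forall x \near 0^'+, P x) -> \forall v \near +oo, P (Psi v).
Proof.
move=> /near_right0P[e e0 eP].
have /near_pinftyP[M M0 MP] := near_inverse_correct.
apply/near_pinftyP; exists (M + `|Phi e|) => [|v Mv]; first by rewrite ltr_pwDl.
have [|v0 vE] := MP v; first by apply: le_trans Mv; rewrite lerDl.
apply: eP => //; apply: inverse_decreasing_le => //; rewrite vE.
by apply: le_trans Mv; have := ler_norm (Phi e); lra.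
Qed.

(** At [x = Psi (y / t)] the hypothesis reads [Phi (m * x) <= y = Phi (Psi y)], and [Phi] reverses
    the order. *)
Lemma inverse_scale_ge (m t : R) : 0 < m -> 0 < t ->
  (\forall x \near 0^'+, Phi (m * x) <= t * Phi x) ->
  \forall y \near +oo, Psi y <= m * Psi (t^-1 * y).
Proof.
move=> m0 t0 /near_inverse H.
have ti0 : 0 < t^-1 by rewrite invr_gt0.
have {}H := near_pinfty_scale ti0 H.
have C1 := near_inverse_correct; have C2 := near_pinfty_scale ti0 C1.
near=> y; have [y0 yE] : 0 < Psi y /\ Phi (Psi y) = y by near: y.
have [ty0 tyE] : 0 < Psi (t^-1 * y) /\ Phi (Psi (t^-1 * y)) = t^-1 * y by near: y.
apply: inverse_decreasing_le; rewrite ?mulr_gt0 // yE.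
have : Phi (m * Psi (t^-1 * y)) <= t * Phi (Psi (t^-1 * y)) by near: y.
by rewrite tyE mulrA divff ?mul1r // gt_eqF.
Unshelve. all: by end_near.
Qed.

Lemma inverse_scale_le (m t : R) : 0 < m -> 0 < t ->
  (\forall x \near 0^'+, t * Phi x <= Phi (m * x)) ->
  \forall y \near +oo, m * Psi (t^-1 * y) <= Psi y.
Proof.
move=> m0 t0 /near_inverse H.
have ti0 : 0 < t^-1 by rewrite invr_gt0.
have {}H := near_pinfty_scale ti0 H.
have C1 := near_inverse_correct; have C2 := near_pinfty_scale ti0 C1.
near=> y; have [y0 yE] : 0 < Psi y /\ Phi (Psi y) = y by near: y.
have [ty0 tyE] : 0 < Psi (t^-1 * y) /\ Phi (Psi (t^-1 * y)) = t^-1 * y by near: y.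
apply: inverse_decreasing_le; rewrite ?mulr_gt0 // yE.
have : t * Phi (Psi (t^-1 * y)) <= Phi (m * Psi (t^-1 * y)) by near: y.
by rewrite tyE mulrA divff ?mul1r // gt_eqF.
Unshelve. all: by end_near.
Qed.

End decreasing_inverse.

(** * Power bounds from a bound on the ratio under doubling *)

Section power_comparison.
Context {R : realType} (h : R -> R) (M : R) (M_gt0 : 0 < M).
Context (h_ni : forall u v : R, M <= u -> u <= v ->
  [/\ 0 < h u, 0 < h v & h v <= h u]).

(** [h x * x ^ s] does not decrease under doubling, and on [[K, 2 * K]] it is at least
    [h (2 * K) * K ^ s]. *)
Lemma power_lower_bound (s : R) : 0 <= s ->
  (\forall x \near +oo, 2 `^ (- s) * h x <= h (2 * x)) ->
  exists2 c : R, 0 < c & \forall x \near +oo, c * x `^ (- s) <= h x.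
Proof.
move=> s0 /near_pinftyP[N N0 NP]; pose K := Num.max M N.
have K0 : 0 < K by rewrite lt_max M_gt0.
have MK : M <= K by rewrite le_max lexx.
have NK : N <= K by rewrite le_max lexx orbT.
have K2 : K <= 2 * K by lra.
have [hK h2K _] := h_ni MK K2.
exists (h (2 * K) * K `^ s); first by rewrite mulr_gt0 ?powR_gt0.
apply/near_pinftyP; exists K => // x Kx; have x0 := lt_le_trans K0 Kx.
rewrite powRN ler_pdivrMr ?powR_gt0 //; move: x Kx x0.
have H : forall x, K <= x -> h (2 * K) * K `^ s <= h x * x `^ s.
  apply: (@multiplicative_propagation _ _ 2) => // [|x Kx|x Kx xK].
  - by rewrite ltr1n.
  - have x0 := lt_le_trans K0 Kx; rewrite powRM ?(ltW x0) // mulrA.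
    rewrite ler_pM2r ?powR_gt0 // -ler_pdivrMr ?powR_gt0 // -powRN (mulrC (h x)).
    by apply: NP; exact: le_trans Kx.
  - have x0 := lt_le_trans K0 Kx.
    have [_ _ hx] := h_ni (le_trans MK Kx) xK.
    rewrite ler_pM // ?powR_ge0 ?(ltW h2K) //.
    by apply: ge0_ler_powR => //; rewrite nnegrE ltW.
by move=> x Kx _; exact: H.
Qed.

(** Here [h x * x ^ s] does not increase under doubling, and [h K * (2 * K) ^ s] bounds it on
    [[K, 2 * K]]. *)
Lemma power_upper_bound (s : R) : 0 <= s ->
  (\forall x \near +oo, h (2 * x) <= 2 `^ (- s) * h x) ->
  exists2 c : R, 0 < c & \forall x \near +oo, h x <= c * x `^ (- s).
Proof.
move=> s0 /near_pinftyP[N N0 NP]; pose K := Num.max M N.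
have K0 : 0 < K by rewrite lt_max M_gt0.
have MK : M <= K by rewrite le_max lexx.
have NK : N <= K by rewrite le_max lexx orbT.
have K2 : K <= 2 * K by lra.
have [hK h2K _] := h_ni MK K2.
exists (h K * (2 * K) `^ s); first by rewrite mulr_gt0 ?powR_gt0 ?mulr_gt0.
apply/near_pinftyP; exists K => // x Kx; have x0 := lt_le_trans K0 Kx.
rewrite powRN ler_pdivlMr ?powR_gt0 // -lerN2; move: x Kx x0.
have H : forall x, K <= x -> - (h K * (2 * K) `^ s) <= - (h x * x `^ s).
  apply: (@multiplicative_propagation _ (fun x => - (h x * x `^ s)) 2) => // [|x Kx|x Kx xK].
  - by rewrite ltr1n.
  - have x0 := lt_le_trans K0 Kx; rewrite lerN2 powRM ?(ltW x0) // mulrA.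
    rewrite ler_pM2r ?powR_gt0 // -ler_pdivlMr ?powR_gt0 // -powRN (mulrC (h x)).
    by apply: NP; exact: le_trans Kx.
  - have x0 := lt_le_trans K0 Kx.
    have [_ hx0 hx] := h_ni MK Kx.
    rewrite lerN2 ler_pM // ?powR_ge0 ?(ltW hx0) //.
    by apply: ge0_ler_powR => //; rewrite nnegrE ltW // (lt_le_trans K0).
by move=> x Kx _; exact: H.
Qed.

Lemma power_negligible (d e : R) : 0 < d -> 0 < e ->
  \forall x \near +oo, x `^ (- d) <= e.
Proof.
move=> d0 e0; apply/near_pinftyP; exists (e^-1 `^ d^-1).
  by rewrite powR_gt0 // invr_gt0.
move=> x ex; have x0 : 0 < x by rewrite (lt_le_trans _ ex) // powR_gt0 // invr_gt0.
rewrite powRN -[leRHS]invrK lef_pV2 ?posrE ?powR_gt0 ?invr_gt0 //.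
have -> : e^-1 = (e^-1 `^ d^-1) `^ d.
  by rewrite -powRrM mulVf ?gt_eqF // powRr1 // invr_ge0 ltW.
by apply: ge0_ler_powR; rewrite ?nnegrE ?powR_ge0 // ltW.
Qed.

(** In [x ^ (- r) = x ^ (- (r - s)) * x ^ (- s)] the first factor vanishes at +oo and the second is
    at most a multiple of [h]. *)
Lemma power_littleo (r s : R) : 0 <= s -> s < r ->
  (\forall x \near +oo, 2 `^ (- s) * h x <= h (2 * x)) ->
  (fun x : R => x `^ (- r)) =o_ (pinfty_nbhs R) h.
Proof.
move=> s0 sr /(power_lower_bound s0)[c c0 hc]; apply/eqoP => e e0.
have h0 : \forall x \near +oo, 0 < h x.
  by apply/near_pinftyP; exists M => // x Mx; have [] := h_ni Mx (lexx x).
have N : \forall x \near +oo, x `^ (- (r - s)) <= e * c.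
  by apply: power_negligible; rewrite ?subr_gt0 ?mulr_gt0.
near=> x.
have x0 : 0 < x by near: x; apply: nbhs_pinfty_gt; exact: num_real.
have hx : 0 < h x by near: x.
rewrite ger0_norm ?powR_ge0 // gtr0_norm //.
have -> : - r = - (r - s) + - s by ring.
rewrite powRD; last by rewrite (gt_eqF x0) implybT.
have H1 : x `^ (- (r - s)) <= e * c by near: x.
have H2 : c * x `^ (- s) <= h x by near: x.
apply: le_trans (ler_wpM2l (ltW e0) H2).
by rewrite mulrA ler_wpM2r ?powR_ge0.
Unshelve. all: by end_near.
Qed.

Lemma littleo_power (r s : R) : 0 <= s -> r < s ->
  (\forall x \near +oo, h (2 * x) <= 2 `^ (- s) * h x) ->
  h =o_ (pinfty_nbhs R) (fun x : R => x `^ (- r)).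
Proof.
move=> s0 rs /(power_upper_bound s0)[c c0 hc]; apply/eqoP => e e0.
have h0 : \forall x \near +oo, 0 < h x.
  by apply/near_pinftyP; exists M => // x Mx; have [] := h_ni Mx (lexx x).
have N : \forall x \near +oo, x `^ (- (s - r)) <= e / c.
  by apply: power_negligible; rewrite ?subr_gt0 ?divr_gt0.
near=> x.
have x0 : 0 < x by near: x; apply: nbhs_pinfty_gt; exact: num_real.
have hx : 0 < h x by near: x.
rewrite gtr0_norm // ger0_norm ?powR_ge0 //.
have H1 : x `^ (- (s - r)) <= e / c by near: x.
have H2 : h x <= c * x `^ (- s) by near: x.
apply: le_trans H2 _.
have -> : - s = - (s - r) + - r by ring.
rewrite powRD; last by rewrite (gt_eqF x0) implybT.
rewrite mulrA ler_wpM2r ?powR_ge0 //.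
by rewrite mulrC -ler_pdivlMr.
Unshelve. all: by end_near.
Qed.

End power_comparison.

(** * Inequalities between real powers, and one-sided bounds from a ratio limit *)

Lemma ltr_powR_gt1 (R : realType) (x u v : R) : 1 < x -> u < v -> x `^ u < x `^ v.
Proof.
move=> x1 uv; have x0 : 0 < x by rewrite (lt_trans _ x1).
have -> : v = u + (v - u) by ring.
rewrite powRD; last by rewrite (gt_eqF x0) implybT.
rewrite ltr_pMr ?powR_gt0 //; have -> : 1 = 1 `^ (v - u) :> R by rewrite powR1.
by apply: gt0_ltr_powR => //; rewrite ?subr_gt0 // nnegrE ltW.
Qed.

Lemma powR_lt_of_root (R : realType) (r x y : R) : 0 < r -> 0 < x -> 0 < y ->
  x < y `^ r^-1 -> x `^ r < y.
Proof.
move=> r0 x0 y0 xy; have -> : y = (y `^ r^-1) `^ r.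
  by rewrite -powRrM mulVf ?gt_eqF // powRr1 // ltW.
by apply: gt0_ltr_powR; rewrite ?nnegrE ?powR_ge0 // ltW.
Qed.

Lemma powR_gt_of_root (R : realType) (r x y : R) : 0 < r -> 0 < y ->
  y `^ r^-1 < x -> y < x `^ r.
Proof.
move=> r0 y0 yx; have {1}-> : y = (y `^ r^-1) `^ r.
  by rewrite -powRrM mulVf ?gt_eqF // powRr1 // ltW.
apply: gt0_ltr_powR; rewrite ?nnegrE ?powR_ge0 //.
by rewrite ltW // (le_lt_trans _ yx) // powR_ge0.
Qed.

Lemma between (R : realType) (x y : R) : x < y -> exists2 z, x < z & z < y.
Proof. by move=> xy; exists ((x + y) / 2); lra. Qed.

Lemma regular_variation_bounds (R : realType) (f : R -> R) (rho : R) :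
  (\forall x \near 0^'+, 0 < f x) -> regular_variation 0^'+ rho%:E f ->
  (forall l t : R, 0 < l -> l `^ rho < t -> \forall x \near 0^'+, f (l * x) <= t * f x) /\
  (forall l t : R, 0 < l -> t < l `^ rho -> \forall x \near 0^'+, t * f x <= f (l * x)).
Proof.
move=> f0 fRV; split=> l t l0 lt.
  have H := cvgr_le _ (fRV l l0) _ lt; near=> x.
  have fx : 0 < f x by near: x.
  rewrite -ler_pdivrMr //; near: x; exact: H.
have H := cvgr_ge _ (fRV l l0) _ lt; near=> x.
have fx : 0 < f x by near: x.
rewrite -ler_pdivlMr //; near: x; exact: H.
Unshelve. all: by end_near.
Qed.

(** * Indices of [Phi] and of its inverse, according to [rho] *)

Section index_transfer.
Context {R : realType} (a : R) (f : R -> R) (rho delta : R).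
Context (a_gt0 : 0 < a) (f_gt0 : forall x : R, 0 < x <= a -> 0 < f x).
Context (f_nondecr : forall x y : R, 0 < x -> x <= y -> y <= a -> f x <= f y).
Context (f_lim0 : f t @[t --> 0^'+] --> (0 : R)) (delta_gt0 : 0 < delta).
Context (f_le : forall l t : R, 0 < l -> l `^ rho < t ->
  \forall x \near 0^'+, f (l * x) <= t * f x).
Context (f_ge : forall l t : R, 0 < l -> t < l `^ rho ->
  \forall x \near 0^'+, t * f x <= f (l * x)).
Context (f_linear : exists2 c : R, 0 < c & \forall x \near 0^'+, c * x <= f x).
Local Notation Phi := (Phi a f delta).
Local Notation Psi := (Phi_inv a f delta).
Local Notation g := (fun t => (minus_inverse a f t)^-1).

Let finv_gt0 (x : R) : 0 < x -> 0 < minus_inverse a f x.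
Proof. exact: minus_inverse_gt0. Qed.

Let g_gt0 (x : R) : 0 < x -> 0 < g x.
Proof. by move=> x0; rewrite invr_gt0 finv_gt0. Qed.

Let g_ni (x y : R) : 0 < x -> x <= y -> g y <= g x.
Proof.
move=> x0 xy; rewrite lef_pV2 ?posrE ?finv_gt0 //; last exact: lt_le_trans xy.
exact: minus_inverse_nondecr.
Qed.

Let Phi_bounds (x y : R) : 0 < x -> x <= y ->
  (y - x) * g y <= Phi x - Phi y <= (y - x) * g x.
Proof. by move=> x0 xy; exact: oriented_integral_bounds. Qed.

Let Phi_decr := integral_decr g_gt0 Phi_bounds.
Let Phi_ni := integral_nonincr g_gt0 Phi_bounds.
Let Phi_cont := integral_continuous g_gt0 g_ni Phi_bounds.

Let Phi_infty (A : R) : \forall x \near 0^'+, A <= Phi x.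
Proof.
case: f_linear => c c0 /(minus_inverse_linear a_gt0 f_gt0 f_nondecr f_lim0 c0) H.
move: A; apply: (integral_unbounded g_gt0 Phi_bounds c0); near=> x.
have x0 : 0 < x by near: x; exact: nbhs_right_gt.
have fx := finv_gt0 x0.
rewrite ler_pdivlMr // mulrC -ler_pdivlMr //; near: x; exact: H.
Unshelve. all: by end_near.
Qed.

Let Phi_scale_le (m l t : R) : 1 < l -> l `^ rho < m -> m / l < t ->
  \forall x \near 0^'+, Phi (m * x) <= t * Phi x.
Proof.
move=> l1 lm mlt; have l0 : 0 < l by rewrite (lt_trans _ l1).
have lr0 : 0 < l `^ rho by rewrite powR_gt0.
have m0 := lt_trans lr0 lm.
(* The strict inequality [l ^ rho < m] leaves room for a progression ratio [q] with
   [l ^ rho < m / q], so that [f_le] still applies to [m / q]. *)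
have [q q1] : exists2 q, 1 < q & q < m / l `^ rho.
  by apply: between; rewrite ltr_pdivlMr // mul1r.
have q0 : 0 < q by rewrite (lt_trans _ q1).
rewrite ltr_pdivlMr // mulrC -ltr_pdivlMr // => lmq.
apply: (integral_scale_le g_gt0 Phi_bounds Phi_infty m0 l0 q1 mlt).
have mq0 : 0 < m / q by rewrite divr_gt0.
have H := minus_inverse_scale_ge a_gt0 f_gt0 f_nondecr f_lim0 l1 mq0 (f_le l0 lmq).
near=> y; have y0 : 0 < y by near: y; exact: nbhs_right_gt.
have my0 : 0 < m / q * y by rewrite mulr_gt0.
rewrite ler_pdivrMr ?finv_gt0 // mulrC ler_pdivlMr ?finv_gt0 //.
near: y; exact: H.
Unshelve. all: by end_near.
Qed.

Let Phi_scale_ge (m l t : R) : 1 < l -> 0 < m -> m < l `^ rho -> t < m / l ->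
  \forall x \near 0^'+, t * Phi x <= Phi (m * x).
Proof.
move=> l1 m0 lm mlt; have l0 : 0 < l by rewrite (lt_trans _ l1).
have [q q1] : exists2 q, 1 < q & q < l `^ rho / m.
  by apply: between; rewrite ltr_pdivlMr // mul1r.
have q0 : 0 < q by rewrite (lt_trans _ q1).
rewrite ltr_pdivlMr // mulrC => lmq.
apply: (integral_scale_ge g_gt0 Phi_bounds Phi_infty m0 l0 q1 mlt).
have mq0 : 0 < m * q by rewrite mulr_gt0.
have H := minus_inverse_scale_le a_gt0 f_gt0 f_nondecr f_lim0 l1 mq0 (f_ge l0 lmq).
near=> y; have y0 : 0 < y by near: y; exact: nbhs_right_gt.
have my0 : 0 < m * q * y by rewrite mulr_gt0.
rewrite ler_pdivlMr ?finv_gt0 // mulrC ler_pdivrMr ?finv_gt0 //.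
near: y; exact: H.
Unshelve. all: by end_near.
Qed.

(** [k] is the inverse of the factor [t] for [Phi], so [m / l < t] becomes [k < l / m]. *)
Let Psi_scale_ge (m l k : R) : 1 < l -> l `^ rho < m -> 0 < k -> k < l / m ->
  \forall y \near +oo, Psi y <= m * Psi (k * y).
Proof.
move=> l1 lm k0 klm; have l0 : 0 < l by rewrite (lt_trans _ l1).
have m0 : 0 < m by rewrite (lt_trans _ lm) // powR_gt0.
rewrite -(invrK k).
apply: (inverse_scale_ge Phi_decr Phi_cont Phi_infty m0); first by rewrite invr_gt0.
apply: (Phi_scale_le l1 lm).
by rewrite -[ltLHS]invrK invf_div ltf_pV2 ?posrE ?divr_gt0.
Qed.

Let Psi_scale_le (m l k : R) : 1 < l -> 0 < m -> m < l `^ rho -> l / m < k ->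
  \forall y \near +oo, m * Psi (k * y) <= Psi y.
Proof.
move=> l1 m0 lm klm; have l0 : 0 < l by rewrite (lt_trans _ l1).
have k0 : 0 < k by rewrite (lt_trans _ klm) // divr_gt0.
rewrite -(invrK k).
apply: (inverse_scale_le Phi_decr Phi_cont Phi_infty m0); first by rewrite invr_gt0.
apply: (Phi_scale_ge l1 m0 lm).
by rewrite -[ltRHS]invrK invf_div ltf_pV2 ?posrE ?divr_gt0.
Qed.

Let Phi_gt0 : \forall x \near 0^'+, 0 < Phi x.
Proof. by have := Phi_infty 1; apply: filterS => x; exact: lt_le_trans. Qed.

Let Psi_ni := inverse_nonincr Phi_decr Phi_cont Phi_infty.

Let Psi_gt0 : \forall y \near +oo, 0 < Psi y.
Proof.
have [M M0 MP] := Psi_ni; apply/near_pinftyP; exists M => // x Mx.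
by have [] := MP _ _ Mx (lexx x).
Qed.

Let Psi_le_scale (l : R) : 1 < l -> \forall y \near +oo, Psi (l * y) <= Psi y.
Proof.
move=> l1; have [M M0 MP] := Psi_ni; apply/near_pinftyP; exists M => // x Mx.
have [|//] := MP _ (l * x) Mx.
by rewrite ler_peMl ?(ltW l1) // (le_trans _ Mx) // ltW.
Qed.

Let Phi_RV0 (r : \bar R) : regular_variation 0^'+ r Phi -> RV0 r Phi.
Proof.
move=> H; have /near_right0P[e e0 eP] := Phi_gt0; exists e; split => //.
  by move=> x /andP[]; exact: eP.
apply: nonincreasing_on_measurable => x y; rewrite !in_itv /= => /andP[x0 _] _.
exact: Phi_ni.
Qed.

Let Psi_RV (r : \bar R) : regular_variation +oo r Psi -> RV r Psi.
Proof.
move=> H; have [M M0 MP] := Psi_ni; exists M; split => //.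
  by move=> x Mx; have [] := MP _ _ Mx (lexx x).
apply: nonincreasing_on_measurable => x y; rewrite !in_itv /= !andbT => Mx _ xy.
by have [] := MP _ _ Mx xy.
Qed.

Let littleo_Psi (r s : R) : 0 <= s -> s < r ->
  (\forall x \near +oo, 2 `^ (- s) * Psi x <= Psi (2 * x)) ->
  (fun x : R => x `^ (- r)) =o_ (pinfty_nbhs R) Psi.
Proof. by have [M M0 MP] := Psi_ni; exact: (power_littleo M0 MP). Qed.

Let Psi_littleo (r s : R) : 0 <= s -> r < s ->
  (\forall x \near +oo, Psi (2 * x) <= 2 `^ (- s) * Psi x) ->
  Psi =o_ (pinfty_nbhs R) (fun x : R => x `^ (- r)).
Proof. by have [M M0 MP] := Psi_ni; exact: (littleo_power M0 MP). Qed.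

(** Since [l ^ 0 = 1], a given [m > 1] allows [l] arbitrarily large: [m / l] is as small as desired,
    whence rapid variation of [Phi], and [m] may be taken close to 1, whence slow variation of its
    inverse. *)
Lemma transfer_index0 : rho = 0 ->
  [/\ RV0 -oo%E Phi, RV 0%:E Psi
    & forall r : R, 0 < r -> (fun x : R => x `^ (- r)) =o_ (pinfty_nbhs R) Psi].
Proof.
move=> rho0.
have ratio_lt (m t : R) : 1 < m -> 0 < t -> exists l, [/\ 1 < l, l `^ rho < m & m / l < t].
  (* This choice gives [m / l = m * t / (t + m) < t]. *)
  move=> m1 t0; exists (1 + m / t).
  have mt0 : 0 < m / t by rewrite divr_gt0 // (lt_trans _ m1).
  rewrite rho0 powRr0 ltrDl; split => //.
  by rewrite ltr_pdivrMr ?addr_gt0 // mulrDr mulrCA divff ?gt_eqF //; lra.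
have Psi_low (l t : R) : 1 < l -> t < 1 -> \forall x \near +oo, t * Psi x <= Psi (l * x).
  move=> l1 t1; have l0 : 0 < l by rewrite (lt_trans _ l1).
  have [m m0 mt] : exists2 m, Num.max 0 t < m & m < 1 by apply: between; rewrite gt_max ltr01.
  move: m0; rewrite gt_max => /andP[m0 tm].
  have mi1 : 1 < m^-1 by rewrite invf_gt1.
  have li0 : 0 < l^-1 by rewrite invr_gt0.
  have [k [k1 km mk]] := ratio_lt _ _ mi1 li0.
  have k0 : 0 < k by rewrite (lt_trans _ k1).
  have H : \forall y \near +oo, Psi y <= m^-1 * Psi (l * y).
    apply: (Psi_scale_ge k1 km) => //.
    by rewrite -[ltRHS]invrK invf_div -[ltLHS]invrK ltf_pV2 // posrE divr_gt0 ?invr_gt0.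
  near=> y; have y0 : 0 < Psi y by near: y.
  apply: (@le_trans _ _ (m * Psi y)); first by rewrite ler_wpM2r // ltW.
  by rewrite -ler_pdivlMl //; near: y.
split.
- apply: Phi_RV0; apply: rapid_variation_of_bounds.
  + by move=> l P; exact: near_right0_scale.
  + by have := Phi_gt0; apply: filterS => x; rewrite invr_gt0.
  + move=> l t l1 t0; have [k [k1 kl lk]] := ratio_lt _ _ l1 t0.
    have H := Phi_scale_le k1 kl lk.
    have P2 := near_right0_scale (lt_trans ltr01 l1) Phi_gt0.
    near=> x; have x0 : 0 < Phi x by near: x.
    have lx0 : 0 < Phi (l * x) by near: x.
    rewrite ler_pdivlMr // mulrC ler_pdivrMr //; near: x; exact: H.
- apply: Psi_RV; apply: regular_variation_of_bounds.
  + by move=> l P; exact: near_pinfty_scale.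
  + exact: Psi_gt0.
  + move=> l t l1; rewrite powRr0 => t1; have H := Psi_le_scale l1.
    near=> y; have y0 : 0 < Psi y by near: y.
    apply: (@le_trans _ _ (Psi y)); first by near: y.
    by rewrite ler_peMl // ltW.
  + by move=> l t l1; rewrite powRr0; exact: Psi_low.
(* Any exponent strictly between 0 and [r] works, as [Psi_low] accepts every factor below 1. *)
- move=> r r0; apply: (@littleo_Psi _ (r / 2)); [lra|lra|].
  apply: Psi_low; first by rewrite ltr1n.
  by rewrite -[ltRHS](powRr0 (2 : R)); apply: ltr_powR_gt1; rewrite ?ltr1n //; lra.
Unshelve. all: by end_near.
Qed.

(** The critical value of [l] is [m ^ p]. There [m / l = m ^ (1 - p)], the index of [Phi], while
    [k = l / m = m ^ (p - 1)] gives [m^-1 = k ^ s], the index of the inverse. *)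
Lemma transfer_index_lt1 : 0 < rho < 1 ->
  [/\ RV0 (1 - 1 / rho)%:E Phi, RV (rho / (rho - 1))%:E Psi
    & forall r : R, 0 < r < - (rho / (rho - 1)) ->
        Psi =o_ (pinfty_nbhs R) (fun x : R => x `^ (- r))].
Proof.
move=> /andP[rho0 rho1]; pose p := rho^-1; pose s := rho / (rho - 1).
have p1 : 1 < p by rewrite invf_gt1.
have p0 : 0 < p by rewrite (lt_trans _ p1).
(* Thus [- s] is the inverse of [p - 1], so [m < l ^ (- s)] amounts to [m ^ (p - 1) < l]. *)
have sE : - s * (p - 1) = 1.
  by rewrite /s /p; field; rewrite gt_eqF //= subr_eq0 lt_eqF.
have s0 : 0 < - s.
  by rewrite -(@pmulr_lgt0 _ (p - 1)) ?subr_gt0 // sE.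
have gt1_pow (l u : R) : 1 < l -> 0 < u -> 1 < l `^ u.
  by move=> l1 u0; rewrite -(powRr0 l); apply: ltr_powR_gt1.
have lpow (l : R) : 0 < l -> l `^ (1 - 1 / rho) = l / l `^ p.
  move=> l0; rewrite div1r powRB; last by rewrite (gt_eqF l0) implybT.
  by rewrite powRr1 // ltW.
have mpow (l m : R) : 0 < l -> 0 < m -> m < l `^ (- s) -> m `^ p < l * m.
  move=> l0 m0 ml; rewrite -mulr_powRB1 ?(ltW m0) // mulrC ltr_pM2r //.
  apply: powR_lt_of_root => //; rewrite ?subr_gt0 //.
  by have -> : (p - 1)^-1 = - s by apply: (mulIf (x := p - 1));
    rewrite ?sE ?mulVf // subr_eq0 gt_eqF.
have powm (l m : R) : 0 < l -> 0 < m -> l `^ (- s) < m -> l * m < m `^ p.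
  move=> l0 m0 ml; rewrite -mulr_powRB1 ?(ltW m0) // (mulrC l) ltr_pM2l //.
  apply: powR_gt_of_root => //; rewrite ?subr_gt0 //.
  by have -> : (p - 1)^-1 = - s by apply: (mulIf (x := p - 1));
    rewrite ?sE ?mulVf // subr_eq0 gt_eqF.
have Psi_up (l t : R) : 1 < l -> l `^ s < t -> \forall x \near +oo, Psi (l * x) <= t * Psi x.
  move=> l1 lt; have l0 : 0 < l by rewrite (lt_trans _ l1).
  have t0 : 0 < t by rewrite (lt_trans _ lt) // powR_gt0.
  have [m] : exists2 m, Num.max 1 t^-1 < m & m < l `^ (- s).
    apply: between; rewrite gt_max gt1_pow //= powRN ltf_pV2 ?posrE //.
    by rewrite powR_gt0.
  rewrite gt_max => /andP[m1 tm] ml; have m0 : 0 < m by rewrite (lt_trans _ m1).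
  (* [m ^ p < k] gives [m < k ^ rho], and [k < l * m] gives [k / m < l]; here [k] acts as the factor
     of [f], and [l] as that of [Psi]. *)
  have [k mk kl] := between (mpow _ _ l0 m0 ml).
  have k1 : 1 < k by rewrite (lt_trans _ mk) // gt1_pow.
  have mkr : m < k `^ rho by apply: powR_gt_of_root.
  have kml : k / m < l by rewrite ltr_pdivrMr.
  have H := Psi_scale_le k1 m0 mkr kml.
  near=> y; have y0 : 0 < Psi y by near: y.
  apply: (@le_trans _ _ (m^-1 * Psi y)); first by rewrite ler_pdivlMl //; near: y.
  by rewrite ler_wpM2r ?(ltW y0) // ltW // -[ltRHS]invrK ltf_pV2 // posrE invr_gt0.
have Psi_low (l t : R) : 1 < l -> t < l `^ s -> \forall x \near +oo, t * Psi x <= Psi (l * x).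
  move=> l1 lt; have l0 : 0 < l by rewrite (lt_trans _ l1).
  (* As [t] may be negative, it is first replaced by a positive [u] that can be inverted. *)
  have [u] : exists2 u, Num.max 0 t < u & u < l `^ s.
    by apply: between; rewrite gt_max powR_gt0.
  rewrite gt_max => /andP[u0 tu] ul.
  have [m lm mu] : exists2 m, l `^ (- s) < m & m < u^-1.
    by apply: between; rewrite powRN ltf_pV2 ?posrE ?powR_gt0.
  have m1 : 1 < m by rewrite (lt_trans _ lm) // gt1_pow.
  have m0 : 0 < m by rewrite (lt_trans _ m1).
  have [k lmk km] := between (powm _ _ l0 m0 lm).
  have k1 : 1 < k by rewrite (lt_trans _ lmk) // mulr_egt1.
  have kmr : k `^ rho < m by apply: powR_lt_of_root => //; rewrite (lt_trans _ k1).
  have H : \forall y \near +oo, Psi y <= m * Psi (l * y).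
    by apply: (Psi_scale_ge k1 kmr) => //; rewrite ltr_pdivlMr.
  near=> y; have y0 : 0 < Psi y by near: y.
  apply: (@le_trans _ _ (m^-1 * Psi y)).
    rewrite ler_wpM2r ?(ltW y0) // (le_trans (ltW tu)) // ltW //.
    by rewrite -[ltLHS]invrK ltf_pV2 // posrE invr_gt0.
  by rewrite ler_pdivrMl //; near: y.
split.
- apply: Phi_RV0; apply: regular_variation_of_bounds.
  + by move=> l P; exact: near_right0_scale.
  + exact: Phi_gt0.
  + move=> l t l1; have l0 : 0 < l by rewrite (lt_trans _ l1).
    rewrite lpow // => lt.
    have lp0 : 0 < l `^ p by rewrite powR_gt0.
    have t0 : 0 < t by rewrite (lt_trans _ lt) // divr_gt0.
    (* [k < l ^ p] yields [k ^ rho < l], and [l / t < k] yields [l / k < t]. *)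
    have [k] : exists2 k, Num.max 1 (l / t) < k & k < l `^ p.
      apply: between; rewrite gt_max gt1_pow //= ltr_pdivrMr // mulrC.
      by rewrite -ltr_pdivrMr.
    rewrite gt_max => /andP[k1 lk] kl; have k0 : 0 < k by rewrite (lt_trans _ k1).
    apply: (@Phi_scale_le l k) => //; first exact: powR_lt_of_root.
    by rewrite ltr_pdivrMr // mulrC -ltr_pdivrMr.
  + move=> l t l1; have l0 : 0 < l by rewrite (lt_trans _ l1).
    rewrite lpow // => lt.
    have lp0 : 0 < l `^ p by rewrite powR_gt0.
    have [u] : exists2 u, Num.max 0 t < u & u < l / l `^ p.
      by apply: between; rewrite gt_max divr_gt0.
    rewrite gt_max => /andP[u0 tu] ul.
    have [k lk ku] : exists2 k, l `^ p < k & k < l / u.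
      apply: between; rewrite ltr_pdivlMr // mulrC.
      by rewrite -ltr_pdivlMr.
    have k1 : 1 < k by rewrite (lt_trans _ lk) // gt1_pow.
    have k0 : 0 < k by rewrite (lt_trans _ k1).
    apply: (@Phi_scale_ge l k) => //; first exact: powR_gt_of_root.
    by rewrite (lt_trans tu) // ltr_pdivlMr // mulrC -ltr_pdivlMr.
- apply: Psi_RV; apply: regular_variation_of_bounds => //.
  by move=> l P; exact: near_pinfty_scale.
- move=> r /andP[r0 rs]; have [v rv vs] := between rs.
  apply: (@Psi_littleo _ v) => //; first by rewrite ltW // (lt_trans r0).
  apply: Psi_up; first by rewrite ltr1n.
  by apply: ltr_powR_gt1; rewrite ?ltr1n // ltrNr.
Unshelve. all: by end_near.
Qed.

(** The constraint is now [m < l]: [m] can be arbitrarily large with [l / m] close to 1, so the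
    inverse varies rapidly, while [Phi] varies slowly. *)
Lemma transfer_index1 : rho = 1 ->
  [/\ RV0 0%:E Phi, RV -oo%E Psi
    & forall r : R, 0 < r -> Psi =o_ (pinfty_nbhs R) (fun x : R => x `^ (- r))].
Proof.
move=> rho1.
have Psi_up (l t : R) : 1 < l -> 0 < t -> \forall x \near +oo, Psi (l * x) <= t * Psi x.
  move=> l1 t0; have l0 : 0 < l by rewrite (lt_trans _ l1).
  (* Chosen so that [m > 1] and [m^-1 <= t]. *)
  pose m := 1 + t^-1; have ti0 : 0 < t^-1 by rewrite invr_gt0.
  have m1 : 1 < m by rewrite ltrDl.
  have m0 : 0 < m by rewrite (lt_trans _ m1).
  have [k mk kl] : exists2 k, m < k & k < l * m by apply: between; rewrite ltr_pMl.
  have k1 := lt_trans m1 mk.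
  have H : \forall y \near +oo, m * Psi (l * y) <= Psi y.
    apply: (@Psi_scale_le _ k) => //; last by rewrite ltr_pdivrMr.
    by rewrite rho1 powRr1 // ltW // (lt_trans _ k1).
  near=> y; have y0 : 0 < Psi y by near: y.
  apply: (@le_trans _ _ (m^-1 * Psi y)); first by rewrite ler_pdivlMl //; near: y.
  rewrite ler_wpM2r ?(ltW y0) // -[leRHS]invrK lef_pV2 ?posrE //.
  by rewrite /m; lra.
split.
- apply: Phi_RV0; apply: regular_variation_of_bounds.
  + by move=> l P; exact: near_right0_scale.
  + exact: Phi_gt0.
  + move=> l t l1; rewrite powRr0 => t1.
    near=> x; have Px : 0 < Phi x by near: x.
    have x0 : 0 < x by near: x; exact: nbhs_right_gt.
    apply: (@le_trans _ _ (Phi x)); last by rewrite ler_peMl // ltW.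
    by apply: Phi_ni => //; rewrite ler_peMl // ltW.
  + move=> l t l1; rewrite powRr0 => t1; have l0 : 0 < l by rewrite (lt_trans _ l1).
    have [u] : exists2 u, Num.max 0 t < u & u < 1 by apply: between; rewrite gt_max ltr01.
    rewrite gt_max => /andP[u0 tu] u1.
    have [k lk ku] : exists2 k, l < k & k < l / u.
      by apply: between; rewrite ltr_pdivlMr // gtr_pMr.
    have k1 := lt_trans l1 lk; have k0 : 0 < k by rewrite (lt_trans _ k1).
    apply: (@Phi_scale_ge l k) => //; first by rewrite rho1 powRr1 // ltW.
    by rewrite (lt_trans tu) // ltr_pdivlMr // mulrC -ltr_pdivlMr.
- apply: Psi_RV; apply: rapid_variation_of_bounds.
  + by move=> l P; exact: near_pinfty_scale.
  + by have := Psi_gt0; apply: filterS => x; rewrite invr_gt0.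
  + move=> l t l1 t0; have H := Psi_up _ _ l1 t0.
    have P2 := near_pinfty_scale (lt_trans ltr01 l1) Psi_gt0.
    near=> x; have x0 : 0 < Psi x by near: x.
    have lx0 : 0 < Psi (l * x) by near: x.
    rewrite ler_pdivlMr // mulrC ler_pdivrMr //; near: x; exact: H.
(* Any exponent above [r] works, as [Psi_up] accepts every positive factor. *)
- move=> r r0; apply: (@Psi_littleo _ (r + 1)); [lra|lra|].
  by apply: Psi_up; rewrite ?ltr1n // powR_gt0.
Unshelve. all: by end_near.
Qed.

End index_transfer.

Theorem theorem3p10 (R : realType) (a : R) (f : R -> R) (rho delta : R)
    (a_gt0 : 0 < a)
    (f_gt0 : forall x : R, 0 < x <= a -> 0 < f x)
    (f_nondecr : forall x y : R, 0 < x -> x <= y -> y <= a -> f x <= f y)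
    (f_RV0 : RV0 rho%:E f)
    (rho01 : 0 <= rho <= 1)
    (f_lim0 : f t @[t --> 0^'+] --> (0 : R))
    (delta_gt0 : 0 < delta) :
  [/\ rho = 0 ->
        [/\ RV0 -oo%E (Phi a f delta),
            RV 0%:E (Phi_inv a f delta)
          & forall r : R, 0 < r ->
              (fun x : R => x `^ (- r)) =o_ (pinfty_nbhs R) (Phi_inv a f delta)],
      0 < rho < 1 ->
        [/\ RV0 (1 - 1 / rho)%:E (Phi a f delta),
            RV (rho / (rho - 1))%:E (Phi_inv a f delta)
          & forall r : R, 0 < r < - (rho / (rho - 1)) ->
              Phi_inv a f delta =o_ (pinfty_nbhs R) (fun x : R => x `^ (- r))]
    & rho = 1 ->
      (exists2 c : R, 0 < c & \forall x \near 0^'+, c * x <= f x) ->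
        [/\ RV0 0%:E (Phi a f delta),
            RV -oo%E (Phi_inv a f delta)
          & forall r : R, 0 < r ->
              Phi_inv a f delta =o_ (pinfty_nbhs R) (fun x : R => x `^ (- r))]].
Proof.
have f_pos : \forall x \near 0^'+, 0 < f x.
  by apply/near_right0P; exists a => // x x0 xa; rewrite f_gt0 // x0.
have [_ [_ _ _ fRV]] := f_RV0.
have [f_le f_ge] := regular_variation_bounds f_pos fRV.
(* For [rho < 1], [2 ^ rho < 2] provides the doubling bound; for [rho = 1] the linear bound is
   assumed. *)
have f_linear : rho < 1 -> exists2 c : R, 0 < c & \forall x \near 0^'+, c * x <= f x.
  move=> rho1; apply: linear_lower_bound => //; first by exists a.
  apply: f_le => //; rewrite -[ltRHS](@powRr1 R 2) //.
  by apply: ltr_powR_gt1; rewrite ?ltr1n.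
split=> [rho0|/[dup] rho01' /andP[_ rho1]|rho1 flin].
- by apply: (transfer_index0 (rho := rho)) => //; apply: f_linear; rewrite rho0.
- by apply: transfer_index_lt1 => //; exact: f_linear.
- exact: (transfer_index1 (rho := rho)).
Qed.
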